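(* A permutation $\pi$ avoids the classical pattern $4312$ if and only if $(S\circ r\circ c\circ Q)(\pi)$ is the identity permutation (i.e. is sorted).
   Context: A permutation $\pi$ contains a classical pattern $p$ of length $k$ if there are indices $j_1<\dots<j_k$ such that $\pi_{j_1}\cdots\pi_{j_k}$ is order-isomorphic to $p$; otherwise it avoids $p$. For a permutation $\pi=\pi_1\cdots\pi_n$: the reverse is $r(\pi)=\pi_n\cdots\pi_1$; the complement is $c(\pi)=(n+1-\pi_1)\cdots(n+1-\pi_n)$. $S$ is the (unlimited depth) stack-sort operator: $S(\varepsilon)=\varepsilon$ and $S(\alpha n\beta)=S(\alpha)S(\beta)n$ where $n$ is the largest letter. $Q$ is queue-sorting: read the input letters $s$ left to right while maintaining a queue (a list ordered by insertion time; removal always takes the earliest-inserted element) and an output word. For each $s$: if the queue is empty or the most recently inserted element of the queue is smaller than $s$, insert $s$ into the queue; otherwise, repeatedly remove the earliest-inserted element of the queue and append it to the output as long as the queue is nonempty and that element is smaller than $s$, and then append $s$ to the output. After the input is exhausted, append the remaining queue elements to the output in insertion order. $Q(\pi)$ is the resulting output. The composition $S\circ r\circ c\circ Q$ applies $Q$ first. *)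

(* Defs.v *)
(* A permutation of {1, ..., n} is given by its one-line notation,
   a word w : seq nat with perm_eq w (iota 1 n). *)
From mathcomp Require Import all_boot.

Set Implicit Arguments.
Unset Strict Implicit.
Unset Printing Implicit Defensive.

Definition is_permutation (n : nat) (w : seq nat) : bool := perm_eq w (iota 1 n).

(* For words with distinct letters, preserving and reflecting [<] is being
   order-isomorphic. *)
Definition contains (p w : seq nat) : Prop :=
  exists j : 'I_(size p) -> 'I_(size w),
    (forall a b : 'I_(size p), a < b -> j a < j b) /\
    (forall a b : 'I_(size p),
       (nth 0 w (j a) < nth 0 w (j b)) = (nth 0 p a < nth 0 p b)).

Definition avoids (p w : seq nat) : Prop := ~ contains p w.

Definition reverse (w : seq nat) : seq nat := rev w.

Definition complement (w : seq nat) : seq nat :=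
  [seq (size w).+1 - x | x <- w].

Definition largest (w : seq nat) : nat := foldr maxn 0 w.

(* [k] is fuel; [size w] is always enough, see [stack_sort_cat]. *)
Fixpoint stack_sort_rec (k : nat) (w : seq nat) : seq nat :=
  match k, w with
  | k'.+1, _ :: _ =>
      let m := largest w in
      let i := index m w in
      stack_sort_rec k' (take i w) ++ stack_sort_rec k' (drop i.+1 w) ++ [:: m]
  | _, _ => [::]
  end.

Definition stack_sort (w : seq nat) : seq nat := stack_sort_rec (size w) w.

(* A queue is listed from the earliest to the most recent insertion; a state
   is the pair (queue, output). *)
Fixpoint dequeue_below (s : nat) (queue output : seq nat) : seq nat * seq nat :=
  match queue with
  | x :: queue' =>
      if x < s then dequeue_below s queue' (rcons output x)
      else (queue, output)
  | [::] => ([::], output)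
  end.

Definition queue_step (st : seq nat * seq nat) (s : nat) : seq nat * seq nat :=
  let: (queue, output) := st in
  if (queue == [::]) || (last 0 queue < s) then (rcons queue s, output)
  else let: (queue', output') := dequeue_below s queue output in
       (queue', rcons output' s).

Definition queue_sort (w : seq nat) : seq nat :=
  let: (queue, output) := foldl queue_step ([::], [::]) w in output ++ queue.

(* The defining equations S(empty) = empty and S(a n b) = S(a) S(b) n. *)
Lemma stack_sort_nil : stack_sort [::] = [::].
Proof. by []. Qed.

Lemma stack_sort_rec_fuel k w :
  size w <= k -> stack_sort_rec k w = stack_sort w.
Proof.
have fuel : forall l k1 k2 v, size v <= l -> l <= k1 -> l <= k2 ->
    stack_sort_rec k1 v = stack_sort_rec k2 v.
  elim=> [|l IH] [|k1] [|k2] [|x v] //= sv lk1 lk2.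
  set u := x :: v; set m := largest u; set i := index m u.
  have st : size (take i u) <= l.
    have im : i <= l.
      rewrite -ltnS; apply: (@leq_trans (size u)); last exact: sv.
      rewrite index_mem /m /largest.
      suff: forall y t, foldr maxn 0 (y :: t) \in y :: t by apply.
      move=> y t; elim: t y => [|z t IHt] y; first by rewrite /= maxn0 inE.
      rewrite [foldr _ _ _]/= -/(foldr maxn 0 (z :: t)).
      by case: leqP => _; rewrite in_cons ?IHt ?eqxx ?orbT.
    by rewrite size_take; case: ifP => // /negbT; rewrite -leqNgt => /leq_trans; apply.
  have sd : size (drop i.+1 u) <= l.
    by rewrite size_drop /= subSS; apply: leq_trans (leq_subr _ _) _.
  by rewrite -/(take i u) -/(drop i.+1 u) (IH k1 k2) // (IH k1 k2).
by move=> wk; apply: (fuel (size w)).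
Qed.

Lemma stack_sort_cat (a b : seq nat) (n : nat) :
  all (ltn^~ n) a -> all (leq^~ n) b ->
  stack_sort (a ++ n :: b) = stack_sort a ++ stack_sort b ++ [:: n].
Proof.
move=> /allP an /allP bn.
have lrg : largest (a ++ n :: b) = n.
  apply/eqP; rewrite eqn_leq /largest foldrE; apply/andP; split.
    apply/bigmax_leqP_seq => x; rewrite mem_cat inE.
    by case/or3P=> [/an /ltnW //|/eqP -> //|/bn].
  by apply: (@leq_bigmax_seq _ _ xpredT id) => //; rewrite mem_cat mem_head orbT.
have idx : index n (a ++ n :: b) = size a.
  rewrite index_cat /= eqxx addn0 ifN //.
  by apply/negP => /an /=; rewrite ltnn.
have eqS k w : w != [::] -> stack_sort_rec k.+1 w =
    stack_sort_rec k (take (index (largest w) w) w) ++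
    stack_sort_rec k (drop (index (largest w) w).+1 w) ++ [:: largest w].
  by case: w.
have sz : size (a ++ n :: b) = (size a + size b).+1.
  by rewrite size_cat /= addnS.
rewrite {1}/stack_sort sz eqS; last by rewrite -size_eq0 sz.
rewrite lrg idx take_size_cat //.
have -> : drop (size a).+1 (a ++ n :: b) = b.
  by rewrite -cat_rcons drop_size_cat ?size_rcons.
by congr (_ ++ (_ ++ _)); apply: stack_sort_rec_fuel; rewrite ?leq_addr ?leq_addl.
Qed.

(* Main.v *)
(* The word [S v] is sorted exactly when [v] avoids 231, and reverse-complement
   turns 231 into 312, so it must be shown that [Q(pi)] contains 312 if and only
   if [pi] contains 4312.  The letters entering the queue are the left-to-right
   maxima; the others are output as soon as they are read.  In an occurrence
   [d c a b] of 4312 the letters [c a b] are no left-to-right maxima, so they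
   keep their order in [Q(pi)].  Conversely let [c a b] be an occurrence of 312
   in [Q(pi)].  The queue is increasing, so [c] is not output by the final
   emptying; let [s >= c] be the letter read when [c] is output.  It did not
   enter the queue, so the last letter [d] of the queue exceeds [s]; whatever
   remains in the queue is larger than [s], so [a] and [b] are read later, in
   this order, and [d s a b] is an occurrence of 4312 in [pi]. *)
Require Import Defs.
From mathcomp Require Import all_boot.
From mathcomp Require Import zify.

Set Implicit Arguments.
Unset Strict Implicit.
Unset Printing Implicit Defensive.

(** * Subsequences and pattern containment *)

Section Subsequences.

Variable T : eqType.
Implicit Types (x : T) (s t u v : seq T).

Lemma subseq_cat_split s u v :
  subseq s (u ++ v) ->
  exists s1 s2, [/\ s = s1 ++ s2, subseq s1 u & subseq s2 v].
Proof.
case/subseqP=> m sz ->; rewrite size_cat in sz.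
exists (mask (take (size u) m) u), (mask (drop (size u) m) v).
rewrite !mask_subseq -mask_cat ?cat_take_drop //.
by rewrite size_take sz; case: ltnP; lia.
Qed.

Lemma subseq_cons_split x s t :
  subseq s (x :: t) -> (exists2 s', s = x :: s' & subseq s' t) \/ subseq s t.
Proof.
case: s => [|y s]; first by right; rewrite sub0seq.
by rewrite /=; case: eqP => [-> st|_ st]; [left; exists s | right].
Qed.

Lemma subseq_map_inv (T' : eqType) (f : T -> T') (s : seq T') t :
  subseq s (map f t) -> exists2 s', subseq s' t & s = map f s'.
Proof.
case/subseqP=> m _ ->; exists (mask m t); first exact: mask_subseq.
by rewrite map_mask.
Qed.

Lemma mem_last_neq0 x s : s != [::] -> last x s \in s.
Proof. by case: s => //= y s _; apply: mem_last. Qed.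

End Subsequences.

(** Trades the embedding of positions for a subword of [w], so that the later inductions can split
    words instead of handling indices. *)
Lemma containsP p w :
  contains p w <->
  exists s, [/\ subseq s w, size s = size p &
    forall a b, a < size p -> b < size p ->
      (nth 0 s a < nth 0 s b) = (nth 0 p a < nth 0 p b)].
Proof.
have wE : w = map (nth 0 w) (iota 0 (size w)) by rewrite map_nth_iota0 ?take_size.
split=> [[j [jmono jiso]]|[s [sw sz siso]]].
  pose l := [seq val (j a) | a <- enum 'I_(size p)].
  have lsz : size l = size p by rewrite size_map size_enum_ord.
  have lE (a : 'I_(size p)) : nth 0 l a = j a.
    by rewrite (nth_map a) ?size_enum_ord // nth_ord_enum.
  exists (map (nth 0 w) l); split; last 1 first.
  - move=> a b ap bp; rewrite !(nth_map 0) ?lsz //.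
    by rewrite (lE (Ordinal ap)) (lE (Ordinal bp)) jiso.
  - rewrite [X in subseq _ X]wE; apply: map_subseq.
    (* The positions in [l] increase, so [l] is the sorted list of its own members within
       [iota 0 (size w)]. *)
    suff -> : l = [seq x <- iota 0 (size w) | x \in l] by apply: filter_subseq.
    apply: (irr_sorted_eq ltn_trans ltnn).
    + apply/(sortedP 0) => i; rewrite lsz => ip.
      by rewrite (lE (Ordinal ip)) (lE (Ordinal (ltnW ip))); apply: jmono => /=.
    + exact: sorted_filter ltn_trans _ _ (iota_ltn_sorted _ _).
    + move=> x; rewrite mem_filter mem_iota add0n /=.
      by case xl: (x \in l) => //=; case/mapP: xl => a _ ->; rewrite ltn_ord.
  - by rewrite size_map.
rewrite wE in sw; have [l lw sE] := subseq_map_inv sw.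
have lsz : size l = size p by rewrite -sz sE size_map.
have lP i : i < size p -> nth 0 l i < size w.
  move=> ip; have := mem_subseq lw (mem_nth 0 (_ : i < size l)).
  by rewrite mem_iota lsz => /(_ ip).
exists (fun a : 'I_(size p) => Ordinal (lP a (ltn_ord a))); split=> a b.
  move=> ab /=; apply: (sorted_ltn_nth ltn_trans); rewrite ?inE ?lsz //.
  exact: (subseq_sorted ltn_trans lw (iota_ltn_sorted _ _)).
by rewrite -siso // sE !(nth_map 0) ?lsz.
Qed.

Lemma contains_4312P w :
  contains [:: 4; 3; 1; 2] w <->
  exists d c a b, subseq [:: d; c; a; b] w /\ a < b < c /\ c < d.
Proof.
rewrite containsP; split.
  case=> s [+ + iso]; case: s iso => [|d [|c [|a [|b [|? ?]]]]] // iso sw _.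
  exists d, c, a, b; split=> //.
  by have := (iso 2 3 erefl erefl, iso 3 1 erefl erefl, iso 1 0 erefl erefl);
    rewrite /= => [[[-> ->] ->]].
case=> d [c [a [b [sw [/andP[ab bc] cd]]]]].
exists [:: d; c; a; b]; split=> //.
by move=> [|[|[|[|//]]]] [|[|[|[|//]]]] _ _ /=; lia.
Qed.

(** * Stack sorting and the pattern 231 *)

(** Cuts the word at the first occurrence of its largest letter, hence the strict bound on the left
    factor only; this matches [stack_sort_cat]. *)
Lemma stack_sort_rect (P : seq nat -> Type) :
  P [::] ->
  (forall a m b, all (ltn^~ m) a -> all (leq^~ m) b -> P a -> P b ->
     P (a ++ m :: b)) ->
  forall w, P w.
Proof.
move=> P0 Pcat w; have [k] := ubnP (size w).
elim: k w => // k IH [//|x w] wk.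
have lw y : y \in x :: w -> y <= largest (x :: w).
  by rewrite /largest foldrE => yw; apply: (@leq_bigmax_seq _ _ xpredT id).
have mw : largest (x :: w) \in x :: w.
  rewrite /largest; elim: (w) (x) => [|z t IHt] y; first by rewrite /= maxn0 inE.
  rewrite [foldr _ _ _]/= -/(foldr maxn 0 (z :: t)).
  by case: leqP => _; rewrite in_cons ?IHt ?eqxx ?orbT.
move: (largest _) mw lw => m mw lw.
have mi : m \notin take (index m (x :: w)) (x :: w).
  by apply/negP => /index_ltn; rewrite ltnn.
have := cat_take_drop (index m (x :: w)) (x :: w).
rewrite (drop_nth 0) ?index_mem // nth_index //.
move: (take _ _) (drop _ _) mi => a b ma wE.
rewrite -wE in wk lw *; rewrite size_cat /= in wk.
apply: Pcat; [| | apply: IH; lia | apply: IH; lia].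
- apply/allP => y ya /=; rewrite ltn_neqAle lw ?mem_cat ?ya // andbT.
  by apply: contraNneq ma => <-.
- by apply/allP => y yb; apply: lw; rewrite mem_cat inE yb !orbT.
Qed.

Lemma perm_stack_sort w : perm_eq (stack_sort w) w.
Proof.
elim/stack_sort_rect: w => // a m b am bm IHa IHb.
by rewrite stack_sort_cat // perm_cat // cats1 perm_rcons perm_cons.
Qed.

(** [stack_sort u ++ stack_sort v ++ [:: m]] is sorted exactly when both sorted factors are and no
    letter of [u] exceeds one of [v]. A violation of the latter forms a 231 with [m] in the
    middle. *)
Lemma sorted_stack_sortP w :
  reflect (forall b c a, subseq [:: b; c; a] w -> b < c -> b <= a)
          (sorted leq (stack_sort w)).
Proof.
rewrite (sorted_pairwise leq_trans).
elim/stack_sort_rect: w => [|u m v um vm IHu IHv]; first by left.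
rewrite stack_sort_cat // !pairwise_cat /= !andbT.
have -> : allrel leq (stack_sort u) (stack_sort v ++ [:: m]) = allrel leq u v.
  rewrite (eq_allrel_meml _ _ (perm_mem (perm_stack_sort u))) allrel_catr allrel1r.
  rewrite (eq_allrel_memr _ _ (perm_mem (perm_stack_sort v))) (_ : all _ u) ?andbT //.
  by apply: sub_all um => x /ltnW.
have -> : allrel leq (stack_sort v) [:: m].
  by rewrite allrel1r (perm_all _ (perm_stack_sort v)).
move/allP: um => um; move/allP: vm => vm.
apply: (iffP and3P) => [[/allrelP uv /IHu Hu /IHv Hv] b c a|H].
  (* Cases on how many letters of the triple lie in [u]: none, one, two or three. *)
  case/subseq_cat_split => -[|x [|y [|z s1]]] [s2 [sE s1u s2v]].
  - rewrite -[s2]sE in s2v; case/subseq_cons_split: s2v => [[_ [-> <-] cav] bc|].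
      by have := vm c (mem_subseq cav (mem_head _ _)); rewrite leqNgt bc.
    exact: Hv.
  - case: sE s1u s2v => <- <-; rewrite sub1seq => bu s2v _.
    have : a \in m :: v := mem_subseq s2v (mem_last c [:: a]).
    rewrite inE => /predU1P[->|av].
      exact/ltnW/um.
    exact: uv.
  - case: sE s1u s2v => <- <- <- s1u; rewrite sub1seq inE => s2v _.
    have bu := mem_subseq s1u (mem_head _ _).
    by case/predU1P: s2v => [->|av]; [exact/ltnW/um | exact: uv].
  - case: s1 sE s1u => [|? ?] //; case: s2 s2v => // _ [-> -> ->]; exact: Hu.
split.
- apply/allrelP => b a bu av; apply: (H b m a); last exact: um.
  by rewrite -cat1s cat_subseq ?sub1seq //= eqxx sub1seq.
- by apply/IHu => b c a s; apply: H; apply: subseq_trans s (prefix_subseq _ _).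
- apply/IHv => b c a s; apply: H; apply: subseq_trans s _.
  by apply: subseq_trans (subseq_cons _ m) (suffix_subseq _ _).
Qed.

(** * Queue sorting and the pattern 312 *)

(* What is still to be output when the queue is [q] and the input [w] remains. *)
Fixpoint queue_run (q w : seq nat) : seq nat :=
  if w is s :: w' then
    if (q == [::]) || (last 0 q < s) then queue_run (rcons q s) w'
    else let i := find (leq s) q in take i q ++ s :: queue_run (drop i q) w'
  else q.

Lemma dequeue_belowE s q o :
  dequeue_below s q o = (drop (find (leq s) q) q, o ++ take (find (leq s) q) q).
Proof.
elim: q o => [|x q IH] o /=; first by rewrite cats0.
by case: ltnP => _ /=; rewrite ?cats0 // IH cat_rcons.
Qed.

Lemma queue_sortE w : queue_sort w = queue_run [::] w.
Proof.
suff gen q o : (let: (q', o') := foldl queue_step (q, o) w in o' ++ q') =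
    o ++ queue_run q w by exact: gen.
elim: w q o => [|s w IH] q o //=.
case: ifP => _; first exact: IH.
by rewrite dequeue_belowE IH cat_rcons -catA.
Qed.

Lemma perm_queue_run q w : perm_eq (queue_run q w) (q ++ w).
Proof.
elim: w q => [|s w IH] q /=; first by rewrite cats0.
case: ifP => _; first by rewrite -cat_rcons.
rewrite -[X in perm_eq _ (X ++ _)](cat_take_drop (find (leq s) q)) -catA perm_cat2l.
by rewrite perm_sym -cat1s perm_catCA cat1s perm_cons perm_sym.
Qed.

(** Describes a step where [s] bypasses the queue: [q1] leaves, and [rcons q2 x] stays, in a form
    showing that it is nonempty with the old last letter [x]. *)
Variant queue_split_spec s q : seq nat -> seq nat -> Prop :=
  QueueSplit q1 x q2 of q = q1 ++ rcons q2 x & all (ltn^~ s) q1 & s <= x &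
      (sorted leq q -> all (leq s) (rcons q2 x)) :
    queue_split_spec s q q1 (rcons q2 x).

Lemma queue_splitP s q :
  ((q == [::]) || (last 0 q < s)) = false ->
  queue_split_spec s q (take (find (leq s) q) q) (drop (find (leq s) q) q).
Proof.
case/norP => q0; rewrite -leqNgt => sq.
have hq : has (leq s) q by apply/hasP; exists (last 0 q); rewrite ?mem_last_neq0.
have iq : find (leq s) q < size q by rewrite -has_find.
have sdrop : sorted leq q -> all (leq s) (drop (find (leq s) q) q).
  move/(drop_sorted (find (leq s) q)); rewrite (drop_nth 0) //= => qs.
  have sh : s <= nth 0 q (find (leq s) q) by apply: (nth_find 0 hq).
  rewrite sh; apply: sub_all (order_path_min leq_trans qs) => y.
  exact: leq_trans.
case/lastP: (drop _ q) sdrop (cat_take_drop (find (leq s) q) q) => [|q2 x] sdrop qE.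
  by have := congr1 size qE; rewrite cats0 size_take iq; lia.
have sx : s <= x by rewrite -qE last_cat last_rcons in sq.
constructor=> //.
  apply/(all_nthP 0) => i; rewrite size_take iq => ii.
  by rewrite nth_take //= ltnNge (before_find 0 ii).
Qed.

(** All letters of the queue stay at or above [u], so each letter below [u] goes straight to the
    output, in reading order. *)
Lemma filter_queue_run u q w :
  q != [::] -> all (leq u) q ->
  [seq x <- queue_run q w | x < u] = [seq x <- w | x < u].
Proof.
have filter0 v : all (leq u) v -> [seq x <- v | x < u] = [::].
  by move=> uv; rewrite -(filter_pred0 v); apply: eq_in_filter => x /(allP uv);
    rewrite leqNgt => /negbTE.
elim: w q => [|s w IH] q q0 uq /=; first exact: filter0.
case: ifP => [|/queue_splitP].
  rewrite (negbTE q0) /= => qs.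
  have us : u <= s.
    by apply: leq_trans (ltnW qs); apply/(allP uq)/mem_last_neq0.
  by rewrite IH ?all_rcons ?us // -?size_eq0 ?size_rcons // ltnNge us.
move: uq => /[swap]; case=> q1 x q2 -> _ _ _; rewrite all_cat => /andP[uq1 uq2].
by rewrite filter_cat filter0 //= IH // -size_eq0 size_rcons.
Qed.

(** The last letter of the queue never decreases, so the letters of [t] never enter and are output
    as they are read. *)
Lemma subseq_queue_run_lt_last t q w :
  q != [::] -> all (ltn^~ (last 0 q)) t ->
  subseq t w -> subseq t (queue_run q w).
Proof.
elim: w t q => [|s w IH] t q q0 tq /=; first by move/eqP=> ->; rewrite sub0seq.
case: ifP => [|/queue_splitP].
  rewrite (negbTE q0) /= => qs /subseq_cons_split[[t' tE _]|tw].
    by move: tq; rewrite tE /= ltnNge (ltnW qs).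
  apply: IH => //; first by rewrite -size_eq0 size_rcons.
  by rewrite last_rcons; apply: sub_all tq => y /ltn_trans; apply.
move: tq => /[swap]; case=> q1 x q2 -> _ _ _; rewrite last_cat last_rcons => tx tw.
apply: subseq_trans (suffix_subseq _ _).
have sub2 t' : all (ltn^~ x) t' -> subseq t' w ->
    subseq t' (queue_run (rcons q2 x) w).
  by move=> tx' tw'; apply: IH; rewrite ?last_rcons // -size_eq0 size_rcons.
case/subseq_cons_split: tw tx => [[t' -> tw'] /andP[_ tx']|tw tx].
  by rewrite /= eqxx sub2.
by apply: subseq_trans (subseq_cons _ _); apply: sub2.
Qed.

(** Once [d] is read, the queue ends with a letter at least [d]: either [d] itself, or the letter
    that kept it out. *)
Lemma subseq_queue_run_below d t q w :
  all (ltn^~ d) t -> subseq (d :: t) w -> subseq t (queue_run q w).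
Proof.
move=> td; elim: w q => [//|s w IH] q.
case/subseq_cons_split => [[_ [<- <-] tw]|dtw] /=.
  case: ifP => [_|/queue_splitP[q1 x q2 _ _ dx _]].
    by apply: subseq_queue_run_lt_last; rewrite ?last_rcons // -size_eq0 size_rcons.
  apply: subseq_trans (suffix_subseq _ _); apply: subseq_trans (subseq_cons _ _).
  apply: subseq_queue_run_lt_last => //; first by rewrite -size_eq0 size_rcons.
  by rewrite last_rcons; apply: sub_all td => y /leq_trans; apply.
case: ifP => _; first exact: IH.
apply: subseq_trans (suffix_subseq _ _); apply: subseq_trans (subseq_cons _ _).
exact: IH.
Qed.

(** The occurrence is sought in [q ++ w] because the letter playing 4 may already be waiting in the
    queue. *)
Lemma queue_run_312 q w c a b :
  uniq (q ++ w) -> sorted leq q -> a < b < c ->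
  subseq [:: c; a; b] (queue_run q w) ->
  exists d c', [/\ subseq [:: d; c'; a; b] (q ++ w), b < c' & c' < d].
Proof.
move=> + + /andP[ab bc]; elim: w q => [|s w IH] q uqw qs /=.
  move=> /(subseq_sorted leq_trans)/(_ qs) /= /andP[]; lia.
case: ifP => [qlast|/queue_splitP qsplit].
  rewrite -cat_rcons in uqw *; apply: IH => //.
  case/orP: qlast => [/eqP -> //|]; move: qs.
  by case: (q) => //= x q'; rewrite rcons_path => -> /ltnW.
move: uqw qs; case: qsplit => q1 x q2 -> q1s sx sq2 uqw qs.
have {}sq2 := sq2 qs; have {}qs := cat_sorted2 qs.
(* Distinctness makes the inequality strict, as the 4 and the 3 of the pattern must differ. *)
have {}sx : s < x.
  rewrite ltn_neqAle sx andbT; apply: contraTneq uqw => ->.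
  by rewrite cat_uniq /= mem_cat mem_rcons mem_head orbT /= andbF.
(* Here [x] plays 4 and [s] plays 3. The remaining queue is at least [s], so [a] and [b] come from
   [w], in this order. *)
have pattern_s : b < s -> subseq [:: a; b] (queue_run (rcons q2 x) w) ->
    exists d c', [/\ subseq [:: d; c'; a; b] ((q1 ++ rcons q2 x) ++ s :: w),
                     b < c' & c' < d].
  move=> bs abR; exists x, s; split=> //.
  have: subseq [:: a; b] [seq y <- queue_run (rcons q2 x) w | y < s].
    by rewrite subseq_filter abR /= bs (ltn_trans ab).
  rewrite filter_queue_run // -?size_eq0 ?size_rcons // subseq_filter => /andP[_ abw].
  rewrite -cat1s; apply: cat_subseq; last by rewrite /= eqxx.
  by rewrite sub1seq mem_cat mem_rcons mem_head orbT.
(* Cases on how many letters of [[:: c; a; b]] lie in [q1]. If none, [c] is [s] or induction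
   applies; if only [c], then [b < c < s]; two or more would put a descent in the sorted [q1]. *)
case/subseq_cat_split => -[|c1 [|a1 s1]] [s2 [sE s1q s2R]].
- rewrite -[s2]sE in s2R; case/subseq_cons_split: s2R => [[_ [cs <-] abR]|caR].
    by apply: pattern_s; rewrite -?cs.
  have [|d [c' [dw bc' c'd]]] := IH _ _ qs.2 caR.
    move: uqw; rewrite -catA cat_uniq => /and3P[_ _].
    by apply: subseq_uniq; rewrite cat_subseq // subseq_cons.
  exists d, c'; split=> //; apply: subseq_trans dw _.
  rewrite -catA; apply: subseq_trans (suffix_subseq _ _).
  by rewrite cat_subseq // subseq_cons.
- case: sE s1q s2R => <- <-; rewrite sub1seq => /(allP q1s) cs.
  have {}cs : c < s := cs.
  case/subseq_cons_split => [[s' [aE _] _]|]; first lia.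
  by apply: pattern_s; lia.
- case: sE s1q => <- <- _ /(subseq_sorted leq_trans)/(_ qs.1) /= /andP[]; lia.
Qed.

Lemma queue_sort_312P w :
  uniq w ->
  (exists c a b, subseq [:: c; a; b] (queue_sort w) /\ a < b < c) <->
  contains [:: 4; 3; 1; 2] w.
Proof.
rewrite queue_sortE contains_4312P => uw; split.
  move=> [c [a [b [sw /[dup] abc /andP[ab _]]]]].
  have [//|//|d [c' [dw bc' c'd]]] := queue_run_312 _ _ abc sw.
  by exists d, c', a, b; rewrite ab.
move=> [d [c [a [b [dw [/[dup] abc /andP[ab bc] cd]]]]]].
exists c, a, b; split=> //; apply: subseq_queue_run_below dw => /=; lia.
Qed.

(** * Reverse-complement and the conclusion *)

Lemma sorted_stack_sort_rcP w :
  (forall x, x \in w -> x <= size w) ->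
  sorted leq (stack_sort (reverse (complement w))) <->
  ~ (exists c a b, subseq [:: c; a; b] w /\ a < b < c).
Proof.
move=> wn; split=> [/sorted_stack_sortP H [c [a [b [sw abc]]]]|H].
  have := H ((size w).+1 - b) ((size w).+1 - a) ((size w).+1 - c).
  rewrite /reverse -[[:: _; _; _]]/(rev [:: (size w).+1 - c; (size w).+1 - a; (size w).+1 - b]).
  rewrite subseq_rev => /(_ (map_subseq _ sw)).
  (* Since [c] is at most [size w], truncated subtraction keeps the image of [c] strictly below that
     of [b]. *)
  have := wn c (mem_subseq sw (mem_head _ _)); lia.
apply/sorted_stack_sortP => b c a.
rewrite -[[:: _; _; _]]/(rev [:: a; c; b]) subseq_rev => /subseq_map_inv.
move=> [[|a' [|c' [|b' [|]]]]] // sw [-> -> ->] bc; rewrite leqNgt; apply/negP => ab.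
apply: H; exists a', c', b'; split=> //; lia.
Qed.

Theorem theorem3p3 (n : nat) (pi : seq nat) (hpi : is_permutation n pi) :
  avoids [:: 4; 3; 1; 2] pi <->
  (stack_sort \o reverse \o complement \o queue_sort) pi = iota 1 n.
Proof.
rewrite /is_permutation in hpi; rewrite /=.
have upi : uniq pi by rewrite (perm_uniq hpi) iota_uniq.
have Qpi : perm_eq (queue_sort pi) (iota 1 n).
  by rewrite queue_sortE; rewrite (permPl (perm_queue_run _ _)).
have szQ : size (queue_sort pi) = n by rewrite (perm_size Qpi) size_iota.
have cQ : perm_eq (complement (queue_sort pi)) (iota 1 n).
  have uc : uniq (complement (queue_sort pi)).
    rewrite map_inj_in_uniq ?(perm_uniq Qpi) ?iota_uniq // => x y.
    by rewrite szQ !(perm_mem Qpi) !mem_iota; lia.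
  have sub : {subset complement (queue_sort pi) <= iota 1 n}.
    by move=> x /mapP[y + ->]; rewrite szQ (perm_mem Qpi) !mem_iota; lia.
  apply: uniq_perm; rewrite ?iota_uniq //.
  by have [] := uniq_min_size uc sub; rewrite // size_map szQ size_iota.
rewrite /avoids -queue_sort_312P // -sorted_stack_sort_rcP; last first.
  by move=> x; rewrite szQ (perm_mem Qpi) mem_iota; lia.
(* A sorted rearrangement of [iota 1 n] is [iota 1 n] itself, so sortedness suffices. *)
split=> [sS|->]; last exact: iota_sorted.
apply: (sorted_eq leq_trans anti_leq sS (iota_sorted _ _)).
by rewrite (permPl (perm_stack_sort _)) perm_rev.
Qed.
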